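(* Let $n\geq 2$ and let $\mathcal{S}_n$ be the $n$-th Schrödinger algebra over $\mathbb{C}$. Then every local derivation $\Delta:\mathcal{S}_n\to\mathcal{S}_n$ is a derivation.
   Context: The $n$-th Schrödinger algebra $\mathcal{S}_n$ is the complex Lie algebra with $\mathbb{C}$-basis $\{e,f,h,z,u_k,v_k \mid k=1,\dots,n\}$ and the following non-trivial brackets (extended bilinearly and by antisymmetry; all other brackets of basis elements are zero): $[h,e]=2e$, $[h,f]=-2f$, $[e,f]=h$, $[u_k,v_j]=\delta_{kj}z$, $[h,u_k]=u_k$, $[h,v_k]=-v_k$, $[e,v_k]=u_k$, $[f,u_k]=v_k$, and $[z,\mathcal{S}_n]=0$, for $1\le k,j\le n$, where $\delta_{kj}$ is the Kronecker delta. A derivation of a Lie algebra $\mathcal{L}$ is a linear map $D:\mathcal{L}\to\mathcal{L}$ with $D([x,y])=[D(x),y]+[x,D(y)]$ for all $x,y\in\mathcal{L}$. A local derivation of $\mathcal{L}$ is a linear map $\Delta:\mathcal{L}\to\mathcal{L}$ such that for every $x\in\mathcal{L}$ there exists a derivation $D_x$ of $\mathcal{L}$ (depending on $x$) with $\Delta(x)=D_x(x)$. *)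

(* Defs.v *)
From HB Require Import structures.
From mathcomp Require Import all_boot all_order all_algebra.

Set Implicit Arguments.
Unset Strict Implicit.
Unset Printing Implicit Defensive.

Import GRing.Theory.
Local Open Scope ring_scope.

HB.mixin Record Lmodule_isLieAlgebra (K : fieldType) L
    of GRing.Lmodule K L := {
  lie : L -> L -> L;
  lie_is_linearl : forall y, linear (lie^~ y);
  lie_is_linearr : forall x, linear (lie x);
  liexx : forall x, lie x x = 0;
  lie_jacobi : forall x y z,
    lie x (lie y z) + lie y (lie z x) + lie z (lie x y) = 0
}.

#[short(type="lieAlgType")]
HB.structure Definition LieAlgebra (K : fieldType) :=
  {L of Lmodule_isLieAlgebra K L & GRing.Lmodule K L}.

Section Derivations.
Variables (K : fieldType) (L : lieAlgType K).

Definition is_derivation (D : {linear L -> L}) : Prop :=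
  forall x y, D (lie x y) = lie (D x) y + lie x (D y).

Definition is_local_derivation (Delta : {linear L -> L}) : Prop :=
  forall x, exists D : {linear L -> L}, is_derivation D /\ Delta x = D x.

End Derivations.

Inductive schrodinger_idx (n : nat) : Type :=
  | Ie | If | Ih | Iz | Iu of 'I_n | Iv of 'I_n.
Arguments Ie {n}.
Arguments If {n}.
Arguments Ih {n}.
Arguments Iz {n}.

Section SchrodingerIdx.
Variable n : nat.

Definition schrodinger_idx_code (i : schrodinger_idx n) :
    'I_4 + ('I_n + 'I_n) :=
  match i with
  | Ie => inl (inord 0) | If => inl (inord 1)
  | Ih => inl (inord 2) | Iz => inl (inord 3)
  | Iu k => inr (inl k) | Iv k => inr (inr k)
  end.

Definition schrodinger_idx_decode (c : 'I_4 + ('I_n + 'I_n)) :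
    schrodinger_idx n :=
  match c with
  | inl k => match val k with 0 => Ie | 1 => If | 2 => Ih | _ => Iz end
  | inr (inl k) => Iu k
  | inr (inr k) => Iv k
  end.

Lemma schrodinger_idx_codeK :
  cancel schrodinger_idx_code schrodinger_idx_decode.
Proof. by case=> //=; rewrite inordK. Qed.

HB.instance Definition _ := Finite.copy (schrodinger_idx n)
  (can_type schrodinger_idx_codeK).

End SchrodingerIdx.

Section Schrodinger.
Variables (K : fieldType) (n : nat).

(* Vectors are identified with their coordinate families in the basis
   e, f, h, z, u_k, v_k. *)
Definition schrodinger : Type := {ffun schrodinger_idx n -> K^o}.

HB.instance Definition _ := Vector.copy schrodinger
  {ffun schrodinger_idx n -> K^o}.

Implicit Types (i j : schrodinger_idx n) (x y z : schrodinger).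

Definition sch_basis i : schrodinger := [ffun j => (j == i)%:R].

(* Each non-trivial bracket is listed in one orientation only; [sch_bracket]
   antisymmetrises the table. *)
Definition sch_table i j : schrodinger :=
  match i, j with
  | Ih, Ie => 2%:R *: sch_basis Ie
  | Ih, If => - 2%:R *: sch_basis If
  | Ie, If => sch_basis Ih
  | Iu k, Iv l => (k == l)%:R *: sch_basis Iz
  | Ih, Iu k => sch_basis (Iu k)
  | Ih, Iv k => - sch_basis (Iv k)
  | Ie, Iv k => sch_basis (Iu k)
  | If, Iu k => sch_basis (Iv k)
  | _, _ => 0
  end.

Definition sch_bracket x y : schrodinger :=
  \sum_i \sum_j (x i * y j) *: (sch_table i j - sch_table j i).

Lemma sch_bracket_linearl y : linear (sch_bracket^~ y).
Proof.
move=> a x1 x2; rewrite /sch_bracket scaler_sumr -big_split /=.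
apply: eq_bigr => i _; rewrite scaler_sumr -big_split /=.
apply: eq_bigr => j _.
by rewrite !ffunE mulrDl scalerDl scalerA mulrA.
Qed.

Lemma sch_bracket_linearr x : linear (sch_bracket x).
Proof.
move=> a y1 y2; rewrite /sch_bracket scaler_sumr -big_split /=.
apply: eq_bigr => i _; rewrite scaler_sumr -big_split /=.
apply: eq_bigr => j _.
by rewrite !ffunE mulrDr scalerDl mulrCA scalerA.
Qed.

Lemma sch_bracketxx x : sch_bracket x x = 0.
Proof.
rewrite /sch_bracket.
under eq_bigr do under eq_bigr do rewrite scalerBr.
under eq_bigr do rewrite sumrB.
rewrite sumrB [X in _ - X]exchange_big /=.
by under [X in _ - X]eq_bigr do under eq_bigr do rewrite mulrC; rewrite subrr.
Qed.

Lemma sch_basisE x : x = \sum_i x i *: sch_basis i.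
Proof.
apply/ffunP=> j; rewrite sum_ffunE (bigD1 j) //= big1 => [|i nij].
  by rewrite !ffunE eqxx addr0 /GRing.scale /= mulr1.
by rewrite !ffunE eq_sym (negPf nij) scaler0.
Qed.

Lemma sch_bracket_basis i j :
  sch_bracket (sch_basis i) (sch_basis j) = sch_table i j - sch_table j i.
Proof.
rewrite /sch_bracket (bigD1 i) //= [X in _ + X]big1 => [|k nki]; last first.
  by rewrite big1 // => l _; rewrite !ffunE (negPf nki) mul0r scale0r.
rewrite addr0 (bigD1 j) //= big1 => [|l nlj].
  by rewrite !ffunE !eqxx mulr1 scale1r addr0.
by rewrite !ffunE (negPf nlj) mulr0 scale0r.
Qed.

Lemma sch_linear_eq0 (f : schrodinger -> schrodinger) :
  linear f -> (forall i, f (sch_basis i) = 0) -> forall x, f x = 0.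
Proof.
move=> lf f0 x.
pose F : {linear schrodinger -> schrodinger} :=
  HB.pack f (GRing.isLinear.Build _ _ _ _ _ lf).
rewrite -[f]/(F : _ -> _) [x]sch_basisE linear_sum big1 // => i _.
by rewrite linearZ /= f0 scaler0.
Qed.

HB.instance Definition _ x := GRing.isLinear.Build _ _ _ _ (sch_bracket x)
  (sch_bracket_linearr x).
Lemma sch_jacobi x y z :
  sch_bracket x (sch_bracket y z) + sch_bracket y (sch_bracket z x)
    + sch_bracket z (sch_bracket x y) = 0.
Proof.
have Pl a x1 x2 w : sch_bracket (a *: x1 + x2) w
    = a *: sch_bracket x1 w + sch_bracket x2 w := sch_bracket_linearl w a x1 x2.
have Pr a x1 x2 w : sch_bracket w (a *: x1 + x2)
    = a *: sch_bracket w x1 + sch_bracket w x2 := sch_bracket_linearr w a x1 x2.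
pose J x y z := sch_bracket x (sch_bracket y z) + sch_bracket y (sch_bracket z x)
    + sch_bracket z (sch_bracket x y).
have AC a (p q r p' q' r' : schrodinger) :
    a *: p + p' + (a *: q + q') + (a *: r + r')
    = a *: (p + q + r) + (p' + q' + r').
  by rewrite !scalerDr (addrACA (a *: p)) (addrACA (a *: p + a *: q)).
change (J x y z = 0).
move: x; refine (@sch_linear_eq0 (fun x => J x y z) _ _) => /= [a x1 x2|i].
  by rewrite /J ?(Pl, Pr) AC.
move: y; refine (@sch_linear_eq0 (fun y => J _ y z) _ _) => /= [a x1 x2|j].
  by rewrite /J ?(Pl, Pr) AC.
move: z; refine (@sch_linear_eq0 (fun z => J _ _ z) _ _) => /= [a x1 x2|k].
  by rewrite /J ?(Pl, Pr) AC.
rewrite {}/J.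
have BN u v : sch_bracket u (- v) = - sch_bracket u v by rewrite linearN.
have BZ a u v : sch_bracket u (a *: v) = a *: sch_bracket u v by rewrite linearZ.
have B0 u : sch_bracket u 0 = 0 by rewrite linear0.
pose V : lmodType K := schrodinger.
have S := (BN, BZ, B0, @subr0 V, @sub0r V, @addr0 V, @add0r V, @scaler0 _ V,
  @oppr0 V, @subrr V, @opprK V, @addNr V, @scaleNr _ V, @scalerN _ V).
have symI (i j : 'I_n) : (i == j) = (j == i) := eq_sym i j.
rewrite !sch_bracket_basis.
case: i => [||||i|i]; case: j => [||||j|j]; case: k => [||||k|k];
  rewrite /= ?S ?sch_bracket_basis /= ?S ?sch_bracket_basis /= ?S //=;
  rewrite ?(symI k) ?(symI j i) ?S //.
all: rewrite !scaler_nat mulr2n.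
all: solve [ by rewrite subrr | by rewrite -opprD addNr | by rewrite addrAC subrr
  | by rewrite addrAC -opprD addNr | by rewrite -addrA addNr
  | by rewrite -addrA -opprD subrr ].
Qed.

HB.instance Definition _ := Lmodule_isLieAlgebra.Build K schrodinger
  sch_bracket_linearl sch_bracket_linearr sch_bracketxx sch_jacobi.

Lemma sch_lieE x y : lie x y = sch_bracket x y. Proof. by []. Qed.

End Schrodinger.

(* Main.v *)
(* Every derivation of S_n is ad a plus an outer derivation z -> d z, u -> u M,
   v -> v M with M + M^T = d.  Let Delta be a local derivation.  On sl2 it is
   skew for the Killing form, and it sends a nilpotent s into s.W, where W is
   the span of the u_k, v_k; hence it agrees on sl2 with some ad a, which we
   subtract.  Once Delta kills sl2, evaluating it on s + w for the nilpotents
   s = e, f, e - f + h and suitable w in W shows that Delta acts on W, up to a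
   component along z, by u -> u M, v -> v M, and Delta z = d z.  Finally, on
   e + u(b) + t z the unknown parameter of the derivation enters only through
   the factor (b.b / 2 - t); taking t = b.b / 2 gives
   bM.b = Delta(u(b))_z + (d / 2) b.b, and comparing b with -b yields both
   Delta(u(b))_z = 0 and M + M^T = d. *)
From HB Require Import structures.
Require Import Defs.
From mathcomp Require Import all_boot all_order all_algebra.
From mathcomp Require Import ring.
From mathcomp Require Import reals.
From mathcomp.real_closed Require Import complex.

Set Implicit Arguments.
Unset Strict Implicit.
Unset Printing Implicit Defensive.

Import GRing.Theory Num.Theory.
Local Open Scope ring_scope.

(** * Inner derivations of a general Lie algebra *)

Section LieAlgebraDerivations.
Variables (K : fieldType) (L : lieAlgType K).
Implicit Types (a x y : L) (D : {linear L -> L}).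

HB.instance Definition _ x :=
  GRing.isLinear.Build K L L _ (lie x) (lie_is_linearr x).

Lemma lieDl x y a : lie (x + y) a = lie x a + lie y a.
Proof. by have := lie_is_linearl a 1 x y; rewrite !scale1r. Qed.

Lemma lie0l x : lie 0 x = 0.
Proof. by apply: (addIr (lie 0 x)); rewrite -lieDl addr0 add0r. Qed.

Lemma lie_antisym x y : lie x y = - lie y x.
Proof.
apply/eqP; rewrite -addr_eq0; apply/eqP.
by have := liexx (x + y); rewrite lieDl !linearD /= !liexx add0r addr0.
Qed.

Lemma ad_derivation a : is_derivation (lie a).
Proof.
move=> x y; have /eqP := lie_jacobi a x y.
rewrite [lie y a]lie_antisym linearN /= -addrA addrC addr_eq0 => /eqP/esym/eqP.
rewrite eqr_oppLR opprD opprK => /eqP ->.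
by rewrite [lie y _]lie_antisym opprK addrC.
Qed.

Lemma derivationD (D1 D2 D : {linear L -> L}) :
    is_derivation D1 -> is_derivation D2 -> (forall x, D x = D1 x + D2 x) ->
  is_derivation D.
Proof.
move=> d1 d2 DE x y; rewrite !DE d1 d2 lieDl linearD /=.
by rewrite addrACA.
Qed.

Lemma derivation_sub_ad D a : is_derivation D -> is_derivation (D \- lie a).
Proof.
move=> dD x y /=; rewrite dD ad_derivation linearB /= lieDl.
rewrite opprD addrACA [lie (- _) y]lie_antisym linearN /= opprK.
by rewrite [lie y _]lie_antisym.
Qed.

Lemma local_derivation_sub_ad D a :
  is_local_derivation D -> is_local_derivation (D \- lie a).
Proof.
move=> lD x; have [D' [dD' DE]] := lD x.
by exists (D' \- lie a); split; [exact: derivation_sub_ad | rewrite /= DE].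
Qed.

End LieAlgebraDerivations.

(** * Coordinates and brackets in the Schrödinger algebra *)

Section Coordinates.
Variables (K : numFieldType) (n : nat).
Local Notation S := (schrodinger K n).
Implicit Types (x y a : S) (b c : 'rV[K]_n).

Definition ucoord x : 'rV[K]_n := \row_k x (Iu k).
Definition vcoord x : 'rV[K]_n := \row_k x (Iv k).

Definition sch_vec (e f h z : K) b c : S :=
  [ffun i => match i with
    | Ie => e | If => f | Ih => h | Iz => z
    | Iu k => b 0 k | Iv k => c 0 k end].

Definition dot b c : K := (b *m c^T) 0 0.

Lemma sum_idx (V : zmodType) (F : schrodinger_idx n -> V) :
  \sum_i F i =
  F Ie + F If + F Ih + F Iz + \sum_k F (Iu k) + \sum_k F (Iv k).
Proof.
have decK : cancel (@schrodinger_idx_decode n) (@schrodinger_idx_code n).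
  case=> [[m lt_m4]|[k|k]] //=.
  by do 4?case: m lt_m4 => [|m] lt_m4 //=; congr inl; apply/val_inj;
    rewrite /= inordK.
rewrite (reindex (@schrodinger_idx_decode n)) /=; last first.
  by exists (@schrodinger_idx_code n) => i _;
    [exact: decK | exact: schrodinger_idx_codeK].
rewrite big_sumType /= big_sumType /= !big_ord_recl big_ord0 /=.
by rewrite !addrA addr0.
Qed.
(** Equality of indices is inherited from the finite encoding; this form computes on constructors,
    as the evaluation of Kronecker factors below requires. *)
Lemma idx_eqE (i j : schrodinger_idx n) :
  (i == j) = match i, j with
             | Ie, Ie | If, If | Ih, Ih | Iz, Iz => true
             | Iu k, Iu l | Iv k, Iv l => k == l
             | _, _ => false
             end.
Proof.
apply/eqP/idP => [->|]; first by case: j => [||||k|k] /=.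
by case: i => [||||k|k]; case: j => [||||l|l] //= /eqP ->.
Qed.

Lemma sch_basis_coord (i j : schrodinger_idx n) :
  sch_basis K i j = (j == i)%:R.
Proof. exact: ffunE. Qed.

Lemma sch_addE x y i : (x + y) i = x i + y i.
Proof. exact: ffunE. Qed.
Lemma sch_oppE x i : (- x) i = - x i.
Proof. exact: ffunE. Qed.
Lemma sch_scaleE t x i : (t *: x) i = t * x i.
Proof. exact: ffunE. Qed.
Lemma sch_zeroE i : (0 : S) i = 0.
Proof. exact: ffunE. Qed.
Definition schE := (sch_addE, sch_oppE, sch_scaleE, sch_zeroE).

Lemma sum_mul_delta (F : 'I_n -> K) k : \sum_l F l * (k == l)%:R = F k.
Proof.
rewrite (bigD1 k) //= eqxx mulr1 big1 ?addr0 // => l.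
by rewrite eq_sym => /negPf ->; rewrite mulr0.
Qed.

(** Exchanging the summation indices in the negative half moves the antisymmetrisation from the
    table to the coefficients, so each table entry is met once. *)
Lemma sch_lie_sum x y i :
  (lie x y : S) i = \sum_p \sum_q (x p * y q - x q * y p) * sch_table K p q i.
Proof.
under [RHS]eq_bigr do under eq_bigr do rewrite mulrBl.
under [RHS]eq_bigr do rewrite sumrB.
rewrite sumrB [X in _ - X]exchange_big /= sch_lieE /sch_bracket sum_ffunE.
rewrite -sumrB; apply: eq_bigr => p _; rewrite sum_ffunE -sumrB.
apply: eq_bigr => q _; rewrite !schE; ring.
Qed.

Lemma sch_table_sum (G : schrodinger_idx n -> schrodinger_idx n -> K) i :
  \sum_p \sum_q G p q * sch_table K p q i =
  match i with
  | Ie => 2 * G Ih Ie | If => - (2 * G Ih If) | Ih => G Ie If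
  | Iz => \sum_k G (Iu k) (Iv k)
  | Iu k => G Ih (Iu k) + G Ie (Iv k)
  | Iv k => G If (Iu k) - G Ih (Iv k)
  end.
Proof.
have s0 (F : 'I_n -> K) : \sum_k F k * 0 = 0 by rewrite -big_distrl /= mulr0.
have sdiag k (F : 'I_n -> K) t :
    \sum_l F l * ((k == l)%:R * t) = F k * t.
  by rewrite -(sum_mul_delta F k) big_distrl /=; apply: eq_bigr => l _;
    rewrite mulrA.
(* Closed form of the inner sum over [q], one row of [sch_table] at a time; the Kronecker factors
   record which coordinate [i] an entry feeds. *)
pose r p : K := match p with
  | Ie => G Ie If * (i == Ih)%:R + \sum_k G Ie (Iv k) * (i == Iu k)%:R
  | If => \sum_k G If (Iu k) * (i == Iv k)%:R
  | Ih => 2 * G Ih Ie * (i == Ie)%:R - 2 * G Ih If * (i == If)%:R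
      + \sum_k G Ih (Iu k) * (i == Iu k)%:R
      - \sum_k G Ih (Iv k) * (i == Iv k)%:R
  | Iz => 0
  | Iu k => G (Iu k) (Iv k) * (i == Iz)%:R
  | Iv k => 0 end.
have rE p : \sum_q G p q * sch_table K p q i = r p.
  rewrite sum_idx; case: p => [||||k|k] /=;
    rewrite !(schE, sch_basis_coord, mulr0, addr0, add0r) ?s0 ?addr0 ?add0r //=.
  - by congr (_ + _); apply: eq_bigr => k _; rewrite sch_basis_coord.
  - by apply: eq_bigr => k _; rewrite sch_basis_coord.
  - rewrite -sumrN; congr (_ + _ + _).
    - ring.
    - by apply: eq_bigr => k _; rewrite sch_basis_coord.
    - by apply: eq_bigr => k _; rewrite schE sch_basis_coord mulrN.
  - by under eq_bigr do rewrite schE sch_basis_coord; rewrite sdiag.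
under eq_bigr do rewrite rE.
rewrite sum_idx /= sumr_const mul0rn.
case: i @r {rE} => [||||k|k] r.
all: rewrite ?idx_eqE /=.
all: rewrite ?(s0, mulr0, mulr1, addr0, add0r, subr0, oppr0, sub0r) //=.
- by apply: eq_bigr => k _; rewrite mulr1.
- under eq_bigr do rewrite idx_eqE;
    under [X in _ + X]eq_bigr do rewrite idx_eqE.
  by rewrite !sum_mul_delta addrC.
- under eq_bigr do rewrite idx_eqE;
    under [X in _ - X]eq_bigr do rewrite idx_eqE.
  by rewrite !sum_mul_delta.
Qed.

Lemma lie_coord x y i :
  (lie x y : S) i = match i with
  | Ie => 2 * (x Ih * y Ie - x Ie * y Ih)
  | If => - (2 * (x Ih * y If - x If * y Ih))
  | Ih => x Ie * y If - x If * y Ie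
  | Iz => dot (ucoord x) (vcoord y) - dot (ucoord y) (vcoord x)
  | Iu k => x Ih * y (Iu k) - x (Iu k) * y Ih
            + (x Ie * y (Iv k) - x (Iv k) * y Ie)
  | Iv k => x If * y (Iu k) - x (Iu k) * y If
            - (x Ih * y (Iv k) - x (Iv k) * y Ih)
  end.
Proof.
rewrite sch_lie_sum (sch_table_sum (fun p q => x p * y q - x q * y p)).
case: i => //; rewrite sumrB /dot !mxE.
by congr (_ - _); apply: eq_bigr => k _; rewrite !mxE // mulrC.
Qed.

Lemma sch_vec_coord e f h z b c i :
  sch_vec e f h z b c i = match i with
  | Ie => e | If => f | Ih => h | Iz => z
  | Iu k => b 0 k | Iv k => c 0 k end.
Proof. exact: ffunE. Qed.

Lemma ucoord_vec e f h z b c : ucoord (sch_vec e f h z b c) = b.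
Proof. by apply/rowP => k; rewrite mxE sch_vec_coord. Qed.

Lemma vcoord_vec e f h z b c : vcoord (sch_vec e f h z b c) = c.
Proof. by apply/rowP => k; rewrite mxE sch_vec_coord. Qed.

Lemma sch_vec_linear t e f h z b c e' f' h' z' b' c' :
  sch_vec (t * e + e') (t * f + f') (t * h + h') (t * z + z')
          (t *: b + b') (t *: c + c') =
  t *: sch_vec e f h z b c + sch_vec e' f' h' z' b' c'.
Proof.
apply/ffunP => i; rewrite !(schE, sch_vec_coord).
by case: i => *; rewrite ?mxE.
Qed.

(** * The dot product on row vectors *)

Lemma dot0l b : dot 0 b = 0.
Proof. by rewrite /dot mul0mx mxE. Qed.
Lemma dotC b c : dot b c = dot c b.
Proof. by rewrite /dot !mxE; apply: eq_bigr => k _; rewrite !mxE mulrC. Qed.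
Lemma dot0r b : dot b 0 = 0.
Proof. by rewrite dotC dot0l. Qed.
Lemma dotDl b b' c : dot (b + b') c = dot b c + dot b' c.
Proof. by rewrite /dot mulmxDl mxE. Qed.
Lemma dotDr b c c' : dot b (c + c') = dot b c + dot b c'.
Proof. by rewrite dotC dotDl !(dotC b). Qed.
Lemma dotZl t b c : dot (t *: b) c = t * dot b c.
Proof. by rewrite /dot -scalemxAl mxE. Qed.
Lemma dotZr t b c : dot b (t *: c) = t * dot b c.
Proof. by rewrite dotC dotZl dotC. Qed.
Lemma dotNl b c : dot (- b) c = - dot b c.
Proof. by rewrite -scaleN1r dotZl mulN1r. Qed.
Lemma dotNr b c : dot b (- c) = - dot b c.
Proof. by rewrite dotC dotNl dotC. Qed.
Lemma dot_mulmx b c (M : 'M[K]_n) : dot b (c *m M) = dot (b *m M^T) c.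
Proof. by rewrite /dot trmx_mul mulmxA. Qed.
Definition dotE :=
  (dot0l, dot0r, dotDl, dotDr, dotNl, dotNr, dotZl, dotZr).

Lemma dot_delta i j (M : 'M[K]_n) :
  dot (delta_mx 0 i *m M) (delta_mx 0 j) = M i j.
Proof. by rewrite /dot -rowE trmx_delta -colE !mxE. Qed.

(** Polarisation: at a sum of two unit vectors only the mixed terms survive. *)
Lemma alternating_skew (M : 'M[K]_n) :
  (forall b, dot (b *m M) b = 0) -> M + M^T = 0.
Proof.
move=> alt; apply/matrixP => i j; rewrite !mxE -!dot_delta.
have := alt (delta_mx 0 i + delta_mx 0 j).
by rewrite mulmxDl !dotE !alt add0r addr0 addrC.
Qed.

Lemma linear_row_mulmx (g : 'rV[K]_n -> 'rV[K]_n) :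
  linear g -> exists M : 'M_n, forall b, g b = b *m M.
Proof.
move=> lg; pose G : {linear 'rV[K]_n -> 'rV[K]_n} :=
  HB.pack g (GRing.isLinear.Build _ _ _ _ _ lg).
by exists (lin1_mx G) => b; rewrite mul_rV_lin1.
Qed.

(** * The outer derivations *)

Definition outer d (M : 'M[K]_n) x : S :=
  sch_vec 0 0 0 (d * x Iz) (ucoord x *m M) (vcoord x *m M).

Lemma ucoord_lie x y :
  ucoord (lie x y) =
  x Ih *: ucoord y - y Ih *: ucoord x + (x Ie *: vcoord y - y Ie *: vcoord x).
Proof. by apply/rowP => k; rewrite mxE lie_coord !mxE; ring. Qed.

Lemma vcoord_lie x y :
  vcoord (lie x y) =
  x If *: ucoord y - y If *: ucoord x - (x Ih *: vcoord y - y Ih *: vcoord x).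
Proof. by apply/rowP => k; rewrite mxE lie_coord !mxE; ring. Qed.

(** The condition says that [M] is an infinitesimal similitude of [dot]; it matters only for the z
    coordinate, where [u(b), v(c)] = (b.c) z. The other coordinates agree because [M] acts alike on
    the u and v parts. *)
Lemma outer_derivation d M (D : {linear S -> S}) :
  M + M^T = d%:M -> (forall x, D x = outer d M x) -> is_derivation D.
Proof.
move=> skewM DE x y; rewrite !DE /outer.
apply/ffunP => -[||||k|k]; rewrite schE !(lie_coord, sch_vec_coord) /=;
  rewrite ?(ucoord_vec, vcoord_vec, ucoord_lie, vcoord_lie).
- by ring.
- by ring.
- by ring.
- have dM b c : dot (b *m M) c + dot b (c *m M) = d * dot b c.
    by rewrite dot_mulmx -dotDl -mulmxDr skewM mul_mx_scalar dotZl.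
  by rewrite mulrBr -!dM; ring.
- by rewrite !(mulmxDl, mulNmx) -!scalemxAl !mxE; ring.
- by rewrite !(mulmxDl, mulNmx) -!scalemxAl !mxE; ring.
Qed.

(** Deduces a goal from one linear equation: the caller supplies the multiplier [k], and [ring] or
    [field] checks the remaining identity. *)
Lemma eq_lincomb (k l r p q : K) : l = r -> p - q = k * (l - r) -> p = q.
Proof. by move=> ->; rewrite subrr mulr0 => /eqP; rewrite subr_eq0 => /eqP. Qed.

Arguments eq_lincomb k {l r p q}.

(** * Agreement with an inner derivation on sl2 *)

Definition evec : S := sch_vec 1 0 0 0 0 0.
Definition fvec : S := sch_vec 0 1 0 0 0 0.
Definition hvec : S := sch_vec 0 0 1 0 0 0.
Definition zvec : S := sch_vec 0 0 0 1 0 0.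
Definition uvec b : S := sch_vec 0 0 0 0 b 0.
Definition vvec b : S := sch_vec 0 0 0 0 0 b.

Lemma sch_decomp x :
  x = x Ie *: evec + x If *: fvec + x Ih *: hvec + x Iz *: zvec
      + uvec (ucoord x) + vvec (vcoord x).
Proof.
apply/ffunP => i; rewrite !sch_addE 4!sch_scaleE !sch_vec_coord.
by case: i => *; rewrite ?mxE; ring.
Qed.

(* The relations on (E, F, H) = (D e, D f, D h) that make D coincide on sl2
   with an inner derivation. *)
Definition sl2_inner_rel (E F H : S) : Prop :=
  [/\ [/\ E If = 0, F Ie = 0, H Ih = 0 & E Ie + F If = 0],
      H If + 2 * E Ih = 0 /\ H Ie + 2 * F Ih = 0,
      [/\ E Iz = 0, F Iz = 0 & H Iz = 0] &
      forall k, [/\ E (Iv k) = 0, F (Iu k) = 0,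
                    E (Iu k) + H (Iv k) = 0 & H (Iu k) - F (Iv k) = 0]].

Lemma sl2_inner E F H : sl2_inner_rel E F H ->
  exists a, [/\ lie a evec = E, lie a fvec = F & lie a hvec = H].
Proof.
case=> -[Ef Fe Hh EF] [HE HF] [Ez Fz Hz] W.
(* The e, f, u, v coordinates solve [a, h] = [H], and the h coordinate solves [a, e] = [E]. The z
   coordinate is central, hence arbitrary. *)
exists (sch_vec (- (H Ie / 2)) (H If / 2) (E Ie / 2) 0
          (\row_k - H (Iu k)) (\row_k H (Iv k))).
split; apply/ffunP => -[||||k|k];
  rewrite !(lie_coord, sch_vec_coord) /=
    ?(ucoord_vec, vcoord_vec, dotE, mxE);
  rewrite ?Ef ?Fe ?Hh ?Ez ?Fz ?Hz; try have [EV FU EH HF'] := W k;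
    rewrite ?EV ?FU; try by field.
- by apply: (eq_lincomb (-2^-1) HE); field.
- by apply: (eq_lincomb (-1) EH); field.
- by apply: (eq_lincomb (-1) EF); field.
- by apply: (eq_lincomb (-2^-1) HF); field.
- by apply: (eq_lincomb 1 HF'); field.
Qed.

Definition coord_eq x y i (H : x = y) : x i = y i :=
  congr1 (fun x : S => x i) H.

(** Applying [D] to the three brackets of sl2 and reading off coordinates gives linear equations.
    With [sl2_inner] this is an explicit first Whitehead lemma for sl2 acting on S_n. *)
Lemma derivation_sl2_inner (D : {linear S -> S}) :
  is_derivation D -> sl2_inner_rel (D evec) (D fvec) (D hvec).
Proof.
move=> dD.
have he : lie (D hvec) evec + lie hvec (D evec) = 2 *: D evec.
  rewrite -dD -linearZ /=; congr (D _); apply/ffunP => -[||||k|k];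
    rewrite !(schE, lie_coord, sch_vec_coord)
      ?(ucoord_vec, vcoord_vec, dotE, mxE);
    ring.
have hf : lie (D hvec) fvec + lie hvec (D fvec) = - 2 *: D fvec.
  rewrite -dD -linearZ /=; congr (D _); apply/ffunP => -[||||k|k];
    rewrite !(schE, lie_coord, sch_vec_coord)
      ?(ucoord_vec, vcoord_vec, dotE, mxE);
    ring.
have ef : lie (D evec) fvec + lie evec (D fvec) = D hvec.
  rewrite -dD; congr (D _); apply/ffunP => -[||||k|k];
    rewrite !(schE, lie_coord, sch_vec_coord)
      ?(ucoord_vec, vcoord_vec, dotE, mxE);
    ring.
have {}he i := coord_eq i he; have {}hf i := coord_eq i hf.
have {}ef i := coord_eq i ef.
move: (D evec) (D fvec) (D hvec) he hf ef => E F H he hf ef.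
have S := (schE, lie_coord, sch_vec_coord).
have T := (ucoord_vec, vcoord_vec, dotE).
split; [split | split | split | move=> k; split].
- by have := he If; rewrite !S => P; apply: (eq_lincomb (-4^-1) P); field.
- by have := hf Ie; rewrite !S => P; apply: (eq_lincomb (4^-1) P); field.
- by have := he Ie; rewrite !S => P; apply: (eq_lincomb (2^-1) P); field.
- have := he Ie; have := ef Ih; rewrite !S => C B.
  have Hh : H Ih = 0 by apply: (eq_lincomb (2^-1) B); field.
  by rewrite Hh in C; apply: (eq_lincomb 1 C); field.
- by have := he Ih; rewrite !S => P; apply: (eq_lincomb (-1) P); field.
- by have := hf Ih; rewrite !S => P; apply: (eq_lincomb 1 P); field.
- by have := he Iz; rewrite !S !T => P; apply: (eq_lincomb (-2^-1) P); field.
- by have := hf Iz; rewrite !S !T => P; apply: (eq_lincomb (2^-1) P); field.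
- by have := ef Iz; rewrite !S !T => P; apply: (eq_lincomb (-1) P); field.
(* Here 3 is a gap of weights: ad h acts on v_k by -1, against the weight 2 of e. *)
- by have := he (Iv k); rewrite !S !mxE => P; apply: (eq_lincomb (-3^-1) P);
    field.
- by have := hf (Iu k); rewrite !S !mxE => P; apply: (eq_lincomb (3^-1) P);
    field.
- by have := he (Iu k); rewrite !S !mxE => P; apply: (eq_lincomb (-1) P); field.
- by have := hf (Iv k); rewrite !S !mxE => P; apply: (eq_lincomb (-1) P); field.
Qed.

(** * Normal form of derivations *)

Lemma uvec_linear t b c : uvec (t *: b + c) = t *: uvec b + uvec c.
Proof. by rewrite -sch_vec_linear !scaler0 !mulr0 !addr0. Qed.
Lemma vvec_linear t b c : vvec (t *: b + c) = t *: vvec b + vvec c.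
Proof. by rewrite -sch_vec_linear !scaler0 !mulr0 !addr0. Qed.

Lemma ucoord_linear t x y : ucoord (t *: x + y) = t *: ucoord x + ucoord y.
Proof. by apply/rowP => k; rewrite !mxE !schE. Qed.
Lemma vcoord_linear t x y : vcoord (t *: x + y) = t *: vcoord x + vcoord y.
Proof. by apply/rowP => k; rewrite !mxE !schE. Qed.

Lemma outerP (D : {linear S -> S}) d M :
    D evec = 0 -> D fvec = 0 -> D hvec = 0 -> D zvec = d *: zvec ->
    (forall b, D (uvec b) = uvec (b *m M)) ->
    (forall b, D (vvec b) = vvec (b *m M)) ->
  forall x, D x = outer d M x.
Proof.
move=> De Df Dh Dz Du Dv x; rewrite {1}[x]sch_decomp.
have DD y z : D (y + z) = D y + D z by exact: linearD.
have DZ t y : D (t *: y) = t *: D y by exact: linearZ.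
rewrite 5!DD 4!DZ De Df Dh Dz Du Dv; apply/ffunP => i.
rewrite !sch_addE 5!sch_scaleE sch_zeroE !sch_vec_coord.
by case: i => *; rewrite ?mxE; ring.
Qed.

(** A derivation killing sl2 commutes with its adjoint action, so it preserves the weight spaces of
    h; [M] is its action on the u part, and applying ad f transports it to the v part. *)
Lemma derivation_outer (D : {linear S -> S}) :
    is_derivation D -> D evec = 0 -> D fvec = 0 -> D hvec = 0 ->
  exists d M, M + M^T = d%:M /\ forall x, D x = outer d M x.
Proof.
move=> dD De Df Dh.
have [M ME] : exists M : 'M_n, forall b, ucoord (D (uvec b)) = b *m M.
  by apply: linear_row_mulmx => t b c;
    rewrite uvec_linear linearP ucoord_linear.
have S := (schE, lie_coord, sch_vec_coord).
have T := (ucoord_vec, vcoord_vec, dotE, mxE).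
have Du b : D (uvec b) = uvec (b *m M).
  have E : lie hvec (uvec b) = uvec b.
    by apply/ffunP => -[||||k|k]; rewrite !S ?T; ring.
  have {}E i : lie hvec (D (uvec b)) i = D (uvec b) i.
    by rewrite -{2}E dD Dh lie0l add0r.
  rewrite -ME; apply/ffunP => -[||||k|k]; rewrite !S ?mxE //.
  - by have := E Ie; rewrite !S => P; apply: (eq_lincomb 1 P); field.
  - by have := E If; rewrite !S => P; apply: (eq_lincomb (-3^-1) P); field.
  - by have := E Ih; rewrite !S => P; apply: (eq_lincomb (-1) P); field.
  - by have := E Iz; rewrite !S !T => P; apply: (eq_lincomb (-1) P); field.
  - by have := E (Iv k); rewrite !S !mxE => P; apply: (eq_lincomb (-2^-1) P);
      field.
have Dv b : D (vvec b) = vvec (b *m M).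
  have E c : lie fvec (uvec c) = vvec c.
    by apply/ffunP => -[||||k|k]; rewrite !S ?T; ring.
  by rewrite -E dD Df lie0l add0r Du E.
(* Weight 0 leaves only h and z; bracketing with e excludes h. *)
have Dz : D zvec = D zvec Iz *: zvec.
  have E0 : lie hvec zvec = 0.
    by apply/ffunP => -[||||k|k]; rewrite !S ?T; ring.
  have F0 : lie evec zvec = 0.
    by apply/ffunP => -[||||k|k]; rewrite !S ?T; ring.
  have E i : lie hvec (D zvec) i = 0.
    by have := dD hvec zvec; rewrite E0 linear0 Dh lie0l add0r => <-;
      rewrite schE.
  have F i : lie evec (D zvec) i = 0.
    by have := dD evec zvec; rewrite F0 linear0 De lie0l add0r => <-;
      rewrite schE.
  apply/ffunP => -[||||k|k]; rewrite !S ?mxE ?mulr0 ?mulr1 //.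
  - by have := E Ie; rewrite !S => P; apply: (eq_lincomb (2^-1) P); field.
  - by have := E If; rewrite !S => P; apply: (eq_lincomb (-2^-1) P); field.
  - by have := F Ie; rewrite !S => P; apply: (eq_lincomb (-2^-1) P); field.
  - by have := E (Iu k); rewrite !S !mxE => P; apply: (eq_lincomb 1 P); field.
  - by have := E (Iv k); rewrite !S !mxE => P; apply: (eq_lincomb (-1) P);
      field.
exists (D zvec Iz), M; split; last exact: outerP.
have uv b c : lie (uvec b) (vvec c) = dot b c *: zvec.
  by apply/ffunP => -[||||k|k]; rewrite !S ?T; ring.
have dM b c : dot (b *m M) c + dot b (c *m M) = D zvec Iz * dot b c.
  have := coord_eq Iz (dD (uvec b) (vvec c)).
  by rewrite Du Dv !uv linearZ /= !schE !sch_vec_coord !mulr1 mulrC.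
apply/matrixP => i j; have := dM (delta_mx 0 i) (delta_mx 0 j).
(* Inserting an identity matrix gives the product of two unit vectors the shape of [dot_delta]. *)
rewrite dot_mulmx dot_delta -(mulmx1 (delta_mx 0 i)) -mulmxA mul1mx !dot_delta.
by rewrite !mxE mulr_natr.
Qed.

Lemma derivation_form (D : {linear S -> S}) : is_derivation D ->
  exists a d M, M + M^T = d%:M /\ forall x, D x = lie a x + outer d M x.
Proof.
move=> dD; have [a [ae af ah]] := sl2_inner (derivation_sl2_inner dD).
have [|||d [M [skewM DE]]] := derivation_outer (derivation_sub_ad a dD).
- by rewrite /= ae subrr.
- by rewrite /= af subrr.
- by rewrite /= ah subrr.
by exists a, d, M; split=> // x; rewrite -DE /= addrC subrK.
Qed.

(** * Local derivations *)

Lemma local_form (D : {linear S -> S}) x : is_local_derivation D ->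
  exists a d M, M + M^T = d%:M /\ D x = lie a x + outer d M x.
Proof.
move=> lD; have [D' [dD' ->]] := lD x.
by have [a [d [M [skewM DE]]]] := derivation_form dD'; exists a, d, M.
Qed.

(** On sl2 the outer part vanishes, so D s = [a, s] with [a] depending on s. The proof uses linear
    conditions on [a, s] that hold for every [a]. *)
Lemma local_sl2_inner (D : {linear S -> S}) :
  is_local_derivation D -> sl2_inner_rel (D evec) (D fvec) (D hvec).
Proof.
move=> lD.
have loc (x y t : K) : exists a, forall i,
    x * D evec i + y * D fvec i + t * D hvec i
    = lie a (sch_vec x y t 0 0 0 : S) i.
  have [a [d [M [_ DE]]]] := local_form (sch_vec x y t 0 0 0) lD.
  exists a => i; rewrite -[lie a _]addr0.
  have <- : outer d M (sch_vec x y t 0 0 0) = 0.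
    apply/ffunP => -[||||k|k];
      by rewrite !(schE, sch_vec_coord)
        ?(ucoord_vec, vcoord_vec) ?mul0mx ?mulr0 ?mxE.
  rewrite -DE -!schE -!linearZ -!linearD /=; congr (D _ i).
  by apply/ffunP => -[||||k|k]; rewrite !(schE, sch_vec_coord) ?mxE; ring.
move: (D evec) (D fvec) (D hvec) loc => E F H loc.
have S := (lie_coord, sch_vec_coord).
(* The Killing form, up to a factor 4, of [a, s] and s. *)
have killing (x y t : K) :
    x * (x * E If + y * F If + t * H If) + y * (x * E Ie + y * F Ie + t * H Ie)
    + 2 * t * (x * E Ih + y * F Ih + t * H Ih) = 0.
  by have [a aE] := loc x y t; rewrite !aE !S; ring.
have zero (x y t : K) : x * E Iz + y * F Iz + t * H Iz = 0.
  by have [a ->] := loc x y t; rewrite !S ucoord_vec vcoord_vec !dotE subrr.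
(* For nilpotent s = x e + y f + t h, the image s.W is the line spanned by
   (x, -t), or (t, y), tensored with K^n. *)
have nilu (x y t : K) k : t ^+ 2 + x * y = 0 ->
    t * (x * E (Iu k) + y * F (Iu k) + t * H (Iu k))
    + x * (x * E (Iv k) + y * F (Iv k) + t * H (Iv k)) = 0.
  move=> nil; have [a aE] := loc x y t; rewrite !aE !S !mxE.
  by apply: (eq_lincomb (- a (Iu k)) nil); ring.
have nilv (x y t : K) k : t ^+ 2 + x * y = 0 ->
    y * (x * E (Iu k) + y * F (Iu k) + t * H (Iu k))
    - t * (x * E (Iv k) + y * F (Iv k) + t * H (Iv k)) = 0.
  move=> nil; have [a aE] := loc x y t; rewrite !aE !S !mxE.
  by apply: (eq_lincomb (- a (Iv k)) nil); ring.
(* The values at e, f, h give the diagonal of the skew form; pairwise sums then give the mixed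
   relations. *)
have Ef : E If = 0 by have P := killing 1 0 0; apply: (eq_lincomb 1 P); ring.
have Fe : F Ie = 0 by have P := killing 0 1 0; apply: (eq_lincomb 1 P); ring.
have Hh : H Ih = 0 by have P := killing 0 0 1; apply: (eq_lincomb (2^-1) P);
  field.
split; [split=> // | split | split | move=> k].
- by have := killing 1 1 0; rewrite Ef Fe => P; apply: (eq_lincomb 1 P); ring.
- by have := killing 1 0 1; rewrite Ef Hh => P; apply: (eq_lincomb 1 P); ring.
- by have := killing 0 1 1; rewrite Fe Hh => P; apply: (eq_lincomb 1 P); ring.
- by have P := zero 1 0 0; apply: (eq_lincomb 1 P); ring.
- by have P := zero 0 1 0; apply: (eq_lincomb 1 P); ring.
- by have P := zero 0 0 1; apply: (eq_lincomb 1 P); ring.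
have Ev : E (Iv k) = 0.
  have P : _ = _ := nilu 1 0 0 k _; apply: (eq_lincomb 1 (P _)); ring.
have Fu : F (Iu k) = 0.
  have P : _ = _ := nilv 0 1 0 k _; apply: (eq_lincomb 1 (P _)); ring.
(* The nilpotents e - f + h and e - f - h: the difference and the sum of their equations separate
   the last two relations. *)
have P : _ = _ := nilu 1 (-1) 1 k _; have {}P := P ltac:(ring).
have Q : _ = _ := nilu 1 (-1) (-1) k _; have {}Q := Q ltac:(ring).
rewrite Ev Fu in P Q; split=> //.
- have R := etrans (congr2 (fun p q => p - q) P Q) (subr0 0).
  by apply: (eq_lincomb (2^-1) R); field.
- have R := etrans (congr2 +%R P Q) (addr0 0).
  by apply: (eq_lincomb (2^-1) R); field.
Qed.

(** Both quadratic terms are even in [b], so the odd [l] vanishes; then [M] minus d / 2 is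
    alternating, hence skew. *)
Lemma quadratic_odd_eq0 (l : 'rV[K]_n -> K) (d : K) (M : 'M[K]_n) :
    (forall b, l (- b) = - l b) ->
    (forall b, dot (b *m M) b = l b + d / 2 * dot b b) ->
  (forall b, l b = 0) /\ M + M^T = d%:M.
Proof.
move=> lN q.
have l0 b : l b = 0.
  have := q (- b); rewrite lN mulNmx !dotE q => P.
  by apply: (eq_lincomb (2^-1) P); field.
split=> //; pose N := M - (d / 2)%:M.
have /alternating_skew : forall b, dot (b *m N) b = 0.
  move=> b; rewrite mulmxBr mul_mx_scalar !dotE q l0; ring.
move/eqP; rewrite /N linearB /= tr_scalar_mx addrACA -opprD subr_eq0 -raddfD /=.
by move=> /eqP ->; congr (_%:M); field.
Qed.

Lemma local_derivation_outer (D : {linear S -> S}) :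
    is_local_derivation D -> D evec = 0 -> D fvec = 0 -> D hvec = 0 ->
  exists d M, M + M^T = d%:M /\ forall x, D x = outer d M x.
Proof.
move=> lD De Df Dh.
have C := (schE, lie_coord, sch_vec_coord).
have T := (ucoord_vec, vcoord_vec, dotE).
have [d Dz] : exists d, D zvec = d *: zvec.
  have [a [d [M [_ ->]]]] := local_form zvec lD; exists d.
  by apply/ffunP => -[||||k|k];
    rewrite !C ?(ucoord_vec, vcoord_vec, dotE) ?mul0mx ?mxE; ring.
have [M ME] : exists M : 'M_n, forall b, ucoord (D (uvec b)) = b *m M.
  by apply: linear_row_mulmx => t b c;
    rewrite uvec_linear linearP ucoord_linear.
have [N NE] : exists N : 'M_n, forall b, vcoord (D (vvec b)) = b *m N.
  by apply: linear_row_mulmx => t b c;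
    rewrite vvec_linear linearP vcoord_linear.
have uN b : uvec (- b) = - uvec b.
  by apply/ffunP => -[||||k|k]; rewrite !C ?mxE ?oppr0.
have vN b : vvec (- b) = - vvec b.
  by apply/ffunP => -[||||k|k]; rewrite !C ?mxE ?oppr0.
(* Only the symmetric part of the unknown [M'] is seen by the quadratic form, and it is the scalar
   d' / 2. *)
have quad d' M' b : M' + M'^T = d'%:M -> dot (b *m M') b = d' / 2 * dot b b.
  move=> /(congr1 (fun P => dot (b *m P) b)).
  rewrite mulmxDr mul_mx_scalar !dotE -dot_mulmx [dot b (_ *m _)]dotC => P.
  by apply: (eq_lincomb (2^-1) P); field.
have Dsl2 b : [/\ D (uvec b) Ie = 0, D (uvec b) If = 0 & D (uvec b) Ih = 0]
           /\ [/\ D (vvec b) Ie = 0, D (vvec b) If = 0 & D (vvec b) Ih = 0].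
  by split; [have [a [d' [M' [_ ->]]]] := local_form (uvec b) lD
            |have [a [d' [M' [_ ->]]]] := local_form (vvec b) lD];
     split; rewrite !C; ring.
have locu b : (forall k, D (uvec b) (Iv k) = 0) /\
    dot (b *m M) b = D (uvec b) Iz + d / 2 * dot b b.
  pose t := dot b b / 2.
  have [a [d' [M' [skewM' DE]]]] := local_form (sch_vec 1 0 0 t b 0) lD.
  have xE : sch_vec 1 0 0 t b 0 = evec + uvec b + t *: zvec.
    by apply/ffunP => -[||||k|k]; rewrite !C ?mxE; ring.
  have {}DE : D (uvec b) + (t * d) *: zvec =
    lie a (sch_vec 1 0 0 t b 0) + outer d' M' (sch_vec 1 0 0 t b 0).
    by rewrite -DE xE !linearD linearZ /= De Dz add0r scalerA.
  have [[ue uf uh] _] := Dsl2 b.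
  (* D u(b) has no sl2 part, so the sl2 part of [a] centralises e and is a multiple of e. *)
  have ah : a Ih = 0.
    by have := coord_eq Ie DE; rewrite !C ue => P;
      apply: (eq_lincomb (-2^-1) P); field.
  have af : a If = 0.
    by have := coord_eq Ih DE; rewrite !C uh => P; apply: (eq_lincomb 1 P);
      field.
  split=> [k|].
    have := coord_eq (Iv k) DE; rewrite !C ?T ah af ?mul0mx ?mxE => P.
    by apply: (eq_lincomb 1 P); ring.
  have Mb : b *m M = b *m M' - vcoord a.
    rewrite -ME; apply/rowP => k; rewrite !mxE; have := coord_eq (Iu k) DE.
    by rewrite !C ?T ah ?mxE => P; apply: (eq_lincomb 1 P); ring.
  have := coord_eq Iz DE;
    rewrite !C !T Mb !dotE (quad _ _ _ skewM') (dotC b) /t => P.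
  by apply: (eq_lincomb (-1) P); field.
have locv b : (forall k, D (vvec b) (Iu k) = 0) /\
    dot (b *m N) b = - D (vvec b) Iz + d / 2 * dot b b.
  (* The sign is opposite to the u case because v is the second factor in [u, v] = z; again [d']
     cancels. *)
  pose t := - dot b b / 2.
  have [a [d' [M' [skewM' DE]]]] := local_form (sch_vec 0 1 0 t 0 b) lD.
  have xE : sch_vec 0 1 0 t 0 b = fvec + vvec b + t *: zvec.
    by apply/ffunP => -[||||k|k]; rewrite !C ?mxE; ring.
  have {}DE : D (vvec b) + (t * d) *: zvec =
    lie a (sch_vec 0 1 0 t 0 b) + outer d' M' (sch_vec 0 1 0 t 0 b).
    by rewrite -DE xE !linearD linearZ /= Df Dz add0r scalerA.
  have [_ [ve vf vh]] := Dsl2 b.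
  have ah : a Ih = 0.
    by have := coord_eq If DE; rewrite !C vf => P;
      apply: (eq_lincomb (2^-1) P); field.
  have ae : a Ie = 0.
    by have := coord_eq Ih DE; rewrite !C vh => P;
      apply: (eq_lincomb (-1) P); field.
  split=> [k|].
    have := coord_eq (Iu k) DE; rewrite !C ?T ah ae ?mul0mx ?mxE => P.
    by apply: (eq_lincomb 1 P); ring.
  have Nb : b *m N = b *m M' - ucoord a.
    rewrite -NE; apply/rowP => k; rewrite !mxE; have := coord_eq (Iv k) DE.
    by rewrite !C ?T ah ?mxE => P; apply: (eq_lincomb 1 P); ring.
  have := coord_eq Iz DE; rewrite !C !T Nb !dotE (quad _ _ _ skewM') /t => P.
  by apply: (eq_lincomb 1 P); field.
have [uz skewM] : (forall b, D (uvec b) Iz = 0) /\ M + M^T = d%:M.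
  apply: quadratic_odd_eq0 => b; last by have [] := locu b.
  by rewrite uN linearN schE.
have [vz _] : (forall b, - D (vvec b) Iz = 0) /\ N + N^T = d%:M.
  apply: (@quadratic_odd_eq0 (fun b => - D (vvec b) Iz)) => b;
    last by have [] := locv b.
  by rewrite vN linearN schE.
have MN b : b *m M = b *m N.
  (* Let s = e - f + h and w = u(b) - v(b). The sl2 part of [a] centralises s, hence is a multiple
     of s, and s kills w. The sum of the u and v coordinates vanishes on s.W and on the outer image
     of w, so it isolates bM - bN = 0. *)
  have [a [d' [M' [_ DE]]]] := local_form (sch_vec 1 (-1) 1 0 b (- b)) lD.
  have xE : sch_vec 1 (-1) 1 0 b (- b) = evec - fvec + hvec + uvec b - vvec b.
    by apply/ffunP => -[||||k|k]; rewrite !C ?mxE; ring.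
  rewrite xE linearB !linearD linearN /= De Df Dh oppr0 !add0r -xE in DE.
  have [[ue uf uh] [ve vf vh]] := Dsl2 b.
  have := coord_eq Ie DE; have := coord_eq If DE; rewrite !C ue uf ve vf => P Q.
  have {}Q : a Ie = a Ih by apply: (eq_lincomb (2^-1) Q); field.
  have {}P : a If = - a Ih by apply: (eq_lincomb (-2^-1) P); field.
  rewrite -ME -NE; apply/rowP => k; rewrite [LHS]mxE [RHS]mxE.
  have := congr2 +%R (coord_eq (Iu k) DE) (coord_eq (Iv k) DE).
  have [uv _] := locu b; have [vu _] := locv b.
  rewrite !C uv vu ucoord_vec vcoord_vec P Q mulNmx !mxE => {}P.
  by apply: (eq_lincomb 1 P); ring.
exists d, M; split=> //; apply: outerP => // b.
- have [[ue uf uh] _] := Dsl2 b; have [uv _] := locu b.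
  by apply/ffunP => -[||||k|k]; rewrite !C -?ME ?ue ?uf ?uh ?uz ?uv ?mxE.
- have [_ [ve vf vh]] := Dsl2 b; have [vu _] := locv b.
  have vz0 : D (vvec b) Iz = 0 by rewrite -[LHS]opprK vz oppr0.
  by apply/ffunP => -[||||k|k]; rewrite !C ?MN -?NE ?ve ?vf ?vh ?vz0 ?vu ?mxE.
Qed.

Lemma local_derivation_is_derivation (D : {linear S -> S}) :
  is_local_derivation D -> is_derivation D.
Proof.
move=> lD; have [a [ae af ah]] := sl2_inner (local_sl2_inner lD).
have [|||d [M [skewM DE]]] :=
  local_derivation_outer (local_derivation_sub_ad a lD).
- by rewrite /= ae subrr.
- by rewrite /= af subrr.
- by rewrite /= ah subrr.
apply: (derivationD (ad_derivation a) (outer_derivation skewM DE)) => x /=.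
by rewrite addrC subrK.
Qed.
End Coordinates.

Local Open Scope complex_scope.

(* [R] is any model of the real numbers, so [R[i]] is the field of complex
   numbers. *)
Theorem theorem3p1 (R : realType) (n : nat) (hn : (2 <= n)%N)
    (Delta : {linear schrodinger R[i] n -> schrodinger R[i] n}) :
  is_local_derivation Delta -> is_derivation Delta.
Proof. exact: local_derivation_is_derivation. Qed.
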